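(* Let $A$ be a Banach algebra and $n\ge 2$ an even integer such that $\tilde Z_1^\ell(A^{(n)})=A^{(n)}$. If $A^{(n)}$ is weakly amenable, then $A^{(n-2)}$ is weakly amenable.
   Context: $A^{(0)}=A$ and $A^{(k)}$ is the dual of $A^{(k-1)}$. For a Banach algebra $C$, the bidual $C^{**}$ carries the first Arens product: $\langle c'c,d\rangle=\langle c',cd\rangle$, $\langle c''c',c\rangle=\langle c'',c'c\rangle$, $\langle c''d'',c'\rangle=\langle c'',d''c'\rangle$ for $c,d\in C$, $c'\in C^*$, $c'',d''\in C^{**}$. For even $k$, $A^{(k+2)}=(A^{(k)})^{**}$ is a Banach algebra under the first Arens product, inductively. $\tilde Z_1^\ell(A^{(n)})$ is the set of $a\in A^{(n)}$ such that $b\mapsto ab$ is continuous from $A^{(n)}$ with the weak$^*$ topology $\sigma(A^{(n)},A^{(n-1)})$ to $A^{(n)}$ with the weak topology $\sigma(A^{(n)},A^{(n+1)})$. A Banach algebra $C$ is weakly amenable if every bounded derivation $D:C\to C^*$ (i.e. $D(xy)=xD(y)+D(x)y$) is inner, i.e. of the form $D(c)=cf-fc$ for some $f\in C^*$, where $C^*$ is the dual $C$-bimodule. *)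

(* Defs.v *)
From HB Require Import structures.
From mathcomp Require Import all_boot all_order all_algebra.
From mathcomp Require Import complex.
From mathcomp Require Import all_classical all_reals all_analysis.

Set Implicit Arguments.
Unset Strict Implicit.
Unset Printing Implicit Defensive.

Import Order.TTheory GRing.Theory Num.Theory.
Import numFieldNormedType.Exports.

Local Open Scope classical_set_scope.
Local Open Scope ring_scope.

(* The scalars of a Banach space. A numFieldType K is an ordered-normed field  *)
(* whose norm takes its values in K itself; asking for completeness and for    *)
(* suprema of bounded sets of real elements makes its real subfield a copy of  *)
(* the reals, so that, by the Gelfand-Mazur theorem, K is the field of real or *)
(* of complex numbers. Both are instances, see below. The suprema are what the *)
(* operator norm of a functional needs.                                        *)
HB.mixin Record NumField_isScalarField K & Num.NumField K := {
  real_supremums : forall A : set K, (forall x, A x -> x \is Num.real) ->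
    A !=set0 -> ubound A !=set0 -> supremums A !=set0 ;
  scalar_complete : forall F : set_system K^o,
    ProperFilter F -> cauchy F -> cvg F }.

#[short(type="scalarFieldType")]
HB.structure Definition ScalarField :=
  {K of NumField_isScalarField K & Num.NumField K}.

Section real_scalars.
Variable R : realType.

Lemma realType_supremums (A : set R) : (forall x, A x -> x \is Num.real) ->
  A !=set0 -> ubound A !=set0 -> supremums A !=set0.
Proof.
move=> _ A0 uA; exists (sup A); split; first exact: sup_upper_bound.
by move=> y uy; apply: ge_sup.
Qed.

HB.instance Definition _ :=
  NumField_isScalarField.Build R realType_supremums (@R_complete R).

End real_scalars.

Section complex_scalars.
Variable R : realType.
Local Open Scope complex_scope.

Lemma complex_supremums (A : set R[i]) : (forall x, A x -> x \is Num.real) ->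
  A !=set0 -> ubound A !=set0 -> supremums A !=set0.
Proof.
move=> rA [a0 Aa0] [M uM].
have AE x : A x -> x = (complex.Re x)%:C by move/rA/complex_realP => [r ->].
pose B := [set complex.Re x | x in A].
have B0 : B !=set0 by exists (complex.Re a0); exists a0.
have lecE (x y : R[i]) : (x <= y) = (complex.Im y == complex.Im x) &&
    (complex.Re x <= complex.Re y) by case: x y => [? ?] [].
have uB (y : R[i]) : ubound A y -> ubound B (complex.Re y).
  by move=> uy _ [x Ax <-]; move: (uy _ Ax); rewrite lecE => /andP[].
have hB : has_sup B by split=> //; exists (complex.Re M); exact: uB.
exists (sup B)%:C; split.
  move=> x Ax; rewrite (AE _ Ax) lecE /= eqxx /=.
  by apply: sup_upper_bound => //; exists x.
move=> y uy; rewrite lecE /=; apply/andP; split.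
  by move: (uy _ Aa0); rewrite (AE _ Aa0) lecE => /andP[].
by apply: ge_sup => //; exact: uB.
Qed.

Let normRe (z : R[i]) : `|complex.Re z|%:C <= `|z|.
Proof.
by case: z => a b; rewrite normc_def lecR /= -sqrtr_sqr ler_wsqrtr// lerDl sqr_ge0.
Qed.

Let normIm (z : R[i]) : `|complex.Im z|%:C <= `|z|.
Proof.
by case: z => a b; rewrite normc_def lecR /= -sqrtr_sqr ler_wsqrtr// lerDr sqr_ge0.
Qed.

Lemma complex_complete (F : set_system R[i]^o) :
  ProperFilter F -> cauchy F -> cvg F.
Proof.
move=> FF /cauchyP Fc.
have part (p : R[i] -> R) : (forall x y, p x - p y = p (x - y)) ->
    (forall z, `|p z|%:C <= `|z|) -> cvg ((p : R[i]^o -> R) @ F).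
  move=> pB np; apply: R_complete; apply/cauchyP => e e0.
  have /Fc[z Fz] : 0 < e%:C by rewrite ltcR.
  exists (p z); rewrite /fmapE /=; apply: filterS Fz => w.
  rewrite -!ball_normE /ball_ /= => zw; rewrite pB -ltcR.
  exact: le_lt_trans (np _) zw.
have ReB (x y : R[i]) : complex.Re x - complex.Re y = complex.Re (x - y).
  by case: x; case: y.
have ImB (x y : R[i]) : complex.Im x - complex.Im y = complex.Im (x - y).
  by case: x; case: y.
have /cvg_ex[/= a Fa] := part _ ReB normRe.
have /cvg_ex[/= b Fb] := part _ ImB normIm.
apply/cvg_ex; exists (a +i* b : R[i]^o).
apply/(@cvgrPdist_le _ R[i]^o _ F _ id) => e e0.
have eE : e = (complex.Re e)%:C.
  by have /complex_realP[r ->] : e \is Num.real by exact: gtr0_real.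
have e'0 : 0 < complex.Re e / 2 by rewrite divr_gt0// -ltcR -eE.
move/cvgrPdist_lt : Fa => /(_ _ e'0); move/cvgrPdist_lt : Fb => /(_ _ e'0).
apply: filterS2 => z Hb Ha.
have -> : (a +i* b - z : R[i]^o) =
    (a - complex.Re z)%:C + 'i * (b - complex.Im z)%:C :> R[i].
  by case: z {Ha Hb} => u v; apply/eqP; rewrite eq_complex /= !(mul0r, mul1r, mulr0, subr0, addr0, add0r) !eqxx.
apply: le_trans (ler_normD _ _) _.
have normC (r : R) : `|r%:C| = `|r|%:C :> R[i].
  by rewrite normc_def /= expr0n addr0 sqrtr_sqr.
have normi : `|'i : R[i]| = 1 by rewrite normc_def /= expr0n expr1n add0r sqrtr1.
rewrite normrM normi mul1r !normC -rmorphD /= eE lecR.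
by rewrite [leRHS]splitr ltW// ltrD.
Qed.

HB.instance Definition _ :=
  NumField_isScalarField.Build R[i] complex_supremums complex_complete.

End complex_scalars.

Section dual.
Variables (K : scalarFieldType) (V : normedModType K).

(* The topological dual: continuous linear forms, with the operator norm.      *)
Definition bounded_form : {pred V -> K^o} :=
  fun f => `[< linear f /\ continuous f >].

Lemma bounded_form_submod_closed : submod_closed bounded_form.
Proof.
split; first by apply/asboolP; split; [move=> a x y /=; rewrite scaler0 addr0|exact: cst_continuous].
move=> a f g /asboolP[lf cf] /asboolP[lg cg]; apply/asboolP; split.
  move=> b x y; rewrite /GRing.add/GRing.scale/= lf lg.
  by rewrite /GRing.scale /= !mulrDr !mulrA [b * a]mulrC addrACA.
by move=> x; apply: cvgD; [apply: cvgZr; exact: cf|exact: cg].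
Qed.

HB.instance Definition _ :=
  GRing.isSubmodClosed.Build K (V -> K^o) bounded_form bounded_form_submod_closed.

Record dual := Dual { dual_fun :> V -> K^o ; _ : dual_fun \in bounded_form }.

HB.instance Definition _ := [isSub for dual_fun].
HB.instance Definition _ := [Choice of dual by <:].
HB.instance Definition _ := [SubChoice_isSubLmodule of dual by <:].

Lemma dualP (f g : dual) : (forall x, f x = g x) -> f = g.
Proof. by move=> fg; apply: val_inj; apply/funext. Qed.

Lemma dual_linear (f : dual) : linear f.
Proof. by case: f => f /= /asboolP[]. Qed.

HB.instance Definition _ (f : dual) :=
  GRing.isLinear.Build K V K^o *%R f (dual_linear f).

Lemma dual_continuous (f : dual) : continuous f.
Proof. by case: f => f /= /asboolP[]. Qed.

Lemma bounded_formP (f : V -> K^o) : linear f ->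
  (exists M, forall x, `|f x| <= M * `|x|) -> f \in bounded_form.
Proof.
move=> lf [M fM]; apply/asboolP; split=> //.
pose H := GRing.isLinear.Build K V K^o *%R f lf.
pose g : {linear V -> K^o} := HB.pack f H.
apply: (@bounded_linear_continuous K V K^o g); apply/ex_bound.
exists `|M|; apply/nbhs_norm0P; exists 1 => //= x /= x1.
apply: le_trans (fM x) _.
rewrite -(ger0_norm (le_trans (normr_ge0 _) (fM x))) normrM normr_id.
by rewrite ler_piMr// ltW.
Qed.

Definition dual_norm (f : dual) : K :=
  supremum 0 [set `|f x| | x in [set x : V | `|x| <= 1]].

Lemma dual_norm_supremums (f : dual) :
  supremums [set `|f x| | x in [set x : V | `|x| <= 1]] (dual_norm f).
Proof.
rewrite /dual_norm /supremum.
set A := [set _ | _ in _].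
have A0 : A !=set0 by exists `|f 0|; exists 0 => //=; rewrite normr0.
rewrite ifF; last by apply/negbTE/set0P.
have : supremums A !=set0.
  apply: real_supremums => //; first by move=> _ [x _ <-]; exact: normr_real.
  have /linear_bounded_continuous/linear_boundedP/pinfty_ex_gt0[M M0 fM] :=
    @dual_continuous f.
  exists M => _ [x x1 <-]; apply: le_trans (fM x) _.
  by rewrite ler_piMr// ltW.
by case=> s As; case: xgetP => [y -> //|/(_ s)].
Qed.

Lemma ler_dual_norm (f : dual) (x : V) : `|f x| <= dual_norm f * `|x|.
Proof.
have [->|x0] := eqVneq x 0; first by rewrite linear0 !normr0 mulr0.
have [ub _] := dual_norm_supremums f.
have nx0 : 0 < `|x| by rewrite normr_gt0.
rewrite -ler_pdivrMr// mulrC -[leLHS](_ : `|f (`|x|^-1 *: x)| = _); last first.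
  by rewrite linearZ normrM normfV normr_id.
by apply: ub; exists (`|x|^-1 *: x) => //=; rewrite normfZV.
Qed.

Lemma dual_norm_le (f : dual) (M : K) :
  (forall x, `|x| <= 1 -> `|f x| <= M) -> dual_norm f <= M.
Proof.
move=> fM; have [_] := dual_norm_supremums f; apply => _ [x x1 <-]; exact: fM.
Qed.

Lemma dual_norm_ge0 (f : dual) : 0 <= dual_norm f.
Proof.
have [ub _] := dual_norm_supremums f; apply: ub; exists 0; last by rewrite linear0 normr0.
by rewrite /= normr0.
Qed.

Lemma dual_normD (f g : dual) : dual_norm (f + g) <= dual_norm f + dual_norm g.
Proof.
apply: dual_norm_le => x x1; apply: le_trans (ler_normD _ _) _.
by apply: lerD; [apply: le_trans (ler_dual_norm f x) _|
  apply: le_trans (ler_dual_norm g x) _]; rewrite ler_piMr// dual_norm_ge0.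
Qed.

Lemma dual_normZ (l : K) (f : dual) : dual_norm (l *: f) = `|l| * dual_norm f.
Proof.
have le k (g : dual) : dual_norm (k *: g) <= `|k| * dual_norm g.
  apply: dual_norm_le => x x1; rewrite normrM ler_wpM2l//.
  by apply: le_trans (ler_dual_norm g x) _; rewrite ler_piMr// dual_norm_ge0.
apply/eqP; rewrite eq_le le /=.
have [->|l0] := eqVneq l 0; first by rewrite normr0 mul0r dual_norm_ge0.
rewrite -ler_pdivlMl ?normr_gt0// -normfV.
by apply: le_trans (le _ _); rewrite scalerA mulVf// scale1r.
Qed.

Lemma dual_norm0_eq0 (f : dual) : dual_norm f = 0 -> f = 0.
Proof.
move=> f0; apply: dualP => x; apply/eqP; rewrite -normr_le0.
by apply: le_trans (ler_dual_norm f x) _; rewrite f0 mul0r.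
Qed.

HB.instance Definition _ :=
  Lmodule_isNormed.Build K dual dual_normD dual_normZ dual_norm0_eq0.

Lemma dual_normE (f : dual) : `|f| = dual_norm f.
Proof. by []. Qed.

Lemma dual_complete (F : set_system dual) :
  ProperFilter F -> cauchy F -> cvg F.
Proof.
move=> FF /cauchyP Fc.
have Fx (x : V) : cvg ((fun f : dual => f x) @ F).
  apply: scalar_complete; apply/cauchyP => e e0.
  have nx : 0 < 1 + `|x| by rewrite ltr_pwDl.
  have /Fc[f Ff] : 0 < e / (1 + `|x|) by rewrite divr_gt0.
  exists (f x); rewrite /fmapE /=; apply: filterS Ff => g.
  rewrite -!ball_normE /ball_ /= => fg.
  apply: le_lt_trans (ler_dual_norm (f - g) x) _.
  rewrite ltr_pdivlMr// in fg; apply: le_lt_trans fg.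
  by apply: ler_wpM2l; rewrite ?dual_norm_ge0// lerDr.
pose g x : K^o := lim ((fun f : dual => f x) @ F).
have gc x : (fun f : dual => f x) @ F --> g x by exact: Fx.
have lg : linear g.
  move=> a x y; apply: (@cvg_unique _ _ ((fun f : dual => f (a *: x + y)) @ F)) => /=.
  - exact: (@norm_hausdorff K K^o).
  - exact: gc.
  have -> : (fun f : dual => f (a *: x + y)) = (fun f : dual => (a *: (f x : K^o) + f y)).
    by apply/funext => f; rewrite linearP.
  by apply: cvgD => //; apply: cvgZr.
have dist e : 0 < e -> exists2 f : dual, F (ball f e) &
    forall x, `|f x - g x| <= e * `|x|.
  move=> e0; have [f Ff] := Fc _ e0; exists f => // x.
  apply/ler_addgt0Pr => d d0.
  move/cvgrPdist_lt : (gc x) => /(_ _ d0) gd.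
  have [h [fh hg]] := filter_ex (filterI Ff gd).
  have -> : f x - g x = (f - h) x + (h x - g x) by rewrite /= addrA subrK.
  apply: le_trans (ler_normD _ _) _; apply: lerD; last by rewrite distrC ltW.
  apply: le_trans (ler_dual_norm (f - h) x) _; rewrite ler_wpM2r//.
  by move: fh; rewrite -ball_normE /ball_ /= => /ltW.
have bg : g \in bounded_form.
  apply: bounded_formP => //; have [f _ fg] := dist 1 ltr01.
  exists (`|f| + 1) => x.
  have -> : g x = f x - (f x - g x) by rewrite opprB addrC subrK.
  by apply: le_trans (ler_normB _ _) _; rewrite mulrDl lerD// ?fg// ler_dual_norm.
apply/cvg_ex; exists (Dual bg).
apply/(@cvgrPdist_le _ dual _ F _ id) => e e0.
have [f Ff fg] := dist (e / 2) (divr_gt0 e0 (ltr0Sn _ 1)).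
apply: filterS Ff => h; rewrite -ball_normE /ball_ /= => fh.
have -> : Dual bg - h = (Dual bg - f) + (f - h) by rewrite addrA subrK.
apply: le_trans (ler_normD _ _) _; rewrite [leRHS]splitr lerD ?(ltW fh)//.
apply: dual_norm_le => x x1 /=; rewrite -normrN opprB.
by apply: le_trans (fg x) _; rewrite ler_piMr// ltW// divr_gt0.
Qed.

HB.instance Definition _ := Uniform_isComplete.Build dual dual_complete.

End dual.

Section banach_algebra.
Variable K : scalarFieldType.

(* Multiplications making V a (not necessarily unital) Banach algebra.         *)
Record banach_mul (V : completeNormedModType K) := BanachMul {
  bmul :> V -> V -> V ;
  bmulA : associative bmul ;
  bmul_linearl : forall y, linear (fun x => bmul x y) ;
  bmul_linearr : forall x, linear (bmul x) ;
  bmul_norm : forall x y, `|bmul x y| <= `|x| * `|y| }.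

Record banachAlgebra := BanachAlgebra {
  balg_space :> completeNormedModType K ;
  balg_mul : banach_mul balg_space }.

Lemma zero_bmulA (V : completeNormedModType K) :
  associative (fun _ _ : V => 0 : V).
Proof. by []. Qed.

Lemma zero_bmul_linear (V : completeNormedModType K) :
  linear (fun _ : V => 0 : V).
Proof. by move=> a x y; rewrite scaler0 addr0. Qed.

Lemma zero_bmul_norm (V : completeNormedModType K) (x y : V) :
  `|0 : V| <= `|x| * `|y|.
Proof. by rewrite normr0 mulr_ge0. Qed.

Definition zero_bmul (V : completeNormedModType K) : banach_mul V :=
  BanachMul (@zero_bmulA V) (fun=> @zero_bmul_linear V)
    (fun=> @zero_bmul_linear V) (@zero_bmul_norm V).

Section arens.
Variables (V : completeNormedModType K) (m : banach_mul V).

Lemma ract_subproof (f : dual V) (c : V) :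
  (fun d => f (m c d)) \in @bounded_form K V.
Proof.
apply: bounded_formP => [a x y|]; first by rewrite bmul_linearr linearP.
exists (`|f| * `|c|) => x; apply: le_trans (ler_dual_norm f _) _.
by rewrite -mulrA ler_wpM2l ?dual_norm_ge0// bmul_norm.
Qed.

(* The dual V-bimodule: <f.c, d> = <f, cd> (ract) and <c.f, d> = <f, dc>       *)
(* (lact).                                                                     *)
Definition ract (f : dual V) (c : V) : dual V := Dual (ract_subproof f c).

Lemma lact_subproof (c : V) (f : dual V) :
  (fun d => f (m d c)) \in @bounded_form K V.
Proof.
apply: bounded_formP => [a x y|]; first by rewrite bmul_linearl linearP.
exists (`|f| * `|c|) => x; apply: le_trans (ler_dual_norm f _) _.
by rewrite -mulrA ler_wpM2l ?dual_norm_ge0// mulrC bmul_norm.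
Qed.

Definition lact (c : V) (f : dual V) : dual V := Dual (lact_subproof c f).

Lemma ract_norm (f : dual V) (c : V) : `|ract f c| <= `|f| * `|c|.
Proof.
apply: dual_norm_le => x x1; apply: le_trans (ler_dual_norm f _) _.
rewrite ler_wpM2l ?dual_norm_ge0//; apply: le_trans (bmul_norm _ _ _) _.
by rewrite ler_piMr.
Qed.

Lemma ract_linearl (c : V) : linear (fun f => ract f c).
Proof. by move=> a f g; apply: dualP. Qed.

Lemma ract_linearr (f : dual V) : linear (ract f).
Proof. by move=> a x y; apply: dualP => d /=; rewrite bmul_linearl linearP. Qed.

Lemma arens_act_subproof (F : dual (dual V)) (f : dual V) :
  (fun c => F (ract f c)) \in @bounded_form K V.
Proof.
apply: bounded_formP => [a x y|]; first by rewrite ract_linearr linearP.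
exists (`|F| * `|f|) => x; apply: le_trans (ler_dual_norm F _) _.
by rewrite -mulrA ler_wpM2l ?dual_norm_ge0// ract_norm.
Qed.

(* <F.f, c> = <F, f.c> *)
Definition arens_act (F : dual (dual V)) (f : dual V) : dual V :=
  Dual (arens_act_subproof F f).

Lemma arens_act_norm (F : dual (dual V)) (f : dual V) :
  `|arens_act F f| <= `|F| * `|f|.
Proof.
apply: dual_norm_le => x x1; apply: le_trans (ler_dual_norm F _) _.
rewrite ler_wpM2l ?dual_norm_ge0//; apply: le_trans (ract_norm _ _) _.
by rewrite ler_piMr.
Qed.

Lemma arens_act_linearl (f : dual V) : linear (fun F => arens_act F f).
Proof. by move=> a F G; apply: dualP. Qed.

Lemma arens_act_linearr (F : dual (dual V)) : linear (arens_act F).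
Proof. by move=> a f g; apply: dualP => c /=; rewrite ract_linearl linearP. Qed.

Lemma arens_subproof (F G : dual (dual V)) :
  (fun f => F (arens_act G f)) \in @bounded_form K (dual V).
Proof.
apply: bounded_formP => [a x y|]; first by rewrite arens_act_linearr linearP.
exists (`|F| * `|G|) => x; apply: le_trans (ler_dual_norm F _) _.
by rewrite -mulrA ler_wpM2l ?dual_norm_ge0// arens_act_norm.
Qed.

(* First Arens product: <FG, f> = <F, G.f> *)
Definition arens (F G : dual (dual V)) : dual (dual V) :=
  Dual (arens_subproof F G).

Lemma arensA : associative arens.
Proof.
move=> F G H; apply: dualP => f /=; congr (F _); apply: dualP => c /=.
congr (G _); apply: dualP => d /=; congr (H _); apply: dualP => e /=.
by rewrite bmulA.
Qed.

Lemma arens_linearl (G : dual (dual V)) : linear (fun F => arens F G).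
Proof. by move=> a F H; apply: dualP. Qed.

Lemma arens_linearr (F : dual (dual V)) : linear (arens F).
Proof.
by move=> a G H; apply: dualP => f /=; rewrite arens_act_linearl linearP.
Qed.

Lemma arens_norm (F G : dual (dual V)) : `|arens F G| <= `|F| * `|G|.
Proof.
apply: dual_norm_le => f f1; apply: le_trans (ler_dual_norm F _) _.
rewrite ler_wpM2l ?dual_norm_ge0//; apply: le_trans (arens_act_norm _ _) _.
by rewrite ler_piMr.
Qed.

Definition arens_mul : banach_mul (dual (dual V)) :=
  BanachMul arensA arens_linearl arens_linearr arens_norm.

End arens.

Fixpoint iter_dual (V : completeNormedModType K) (k : nat) :
    completeNormedModType K :=
  if k is j.+1 then dual (iter_dual V j) else V.

(* For even k, the iterated first Arens product on the k-th dual. Odd duals    *)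
(* carry no product of interest; they get the zero product as a dummy value.   *)
Fixpoint iter_dual_mul (A : banachAlgebra) (k : nat) :
    banach_mul (iter_dual A k) :=
  match k return banach_mul (iter_dual A k) with
  | 0 => balg_mul A
  | 1 => zero_bmul _
  | j.+2 => arens_mul (iter_dual_mul A j)
  end.

Definition iter_dual_alg (A : banachAlgebra) (k : nat) : banachAlgebra :=
  BanachAlgebra (iter_dual_mul A k).

(* The topology sigma(X, Y) of a pairing X x Y -> K: initial topology on X for *)
(* the map sending x to the function y |-> p x y, for pointwise convergence.   *)
Definition sigma_topology (X Y : Type) (p : X -> Y -> K) : Type :=
  initial_topology (p : X -> {ptws Y -> K^o}).

HB.instance Definition _ (X : choiceType) (Y : Type) (p : X -> Y -> K) :=
  Topological.copy (sigma_topology p)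
    (initial_topology (p : X -> {ptws Y -> K^o})).

(* Pairing of the n-th dual with the (n-1)-th one; dummy value for n = 0.      *)
Definition predual_pairing (V : completeNormedModType K) (n : nat) :
    iter_dual V n -> iter_dual V n.-1 -> K :=
  match n return iter_dual V n -> iter_dual V n.-1 -> K with
  | 0 => fun _ _ => 0
  | _.+1 => fun f v => f v
  end.

Definition dual_pairing (V : completeNormedModType K) (n : nat)
  (v : iter_dual V n) (f : iter_dual V n.+1) : K := f v.

Definition Ztilde1l (A : banachAlgebra) (n : nat) : set (iter_dual A n) :=
  [set a | continuous (iter_dual_mul A n a :
     sigma_topology (@predual_pairing A n) ->
     sigma_topology (@dual_pairing A n))].

Definition bounded_derivation (C : banachAlgebra) (D : C -> dual C) : Prop :=
  [/\ linear D,
      exists M, forall x, `|D x| <= M * `|x| &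
      forall x y, D (balg_mul C x y) =
        lact (balg_mul C) x (D y) + ract (balg_mul C) (D x) y].

Definition weakly_amenable (C : banachAlgebra) : Prop :=
  forall D : C -> dual C, bounded_derivation D ->
    exists f : dual C, forall c : C,
      D c = lact (balg_mul C) c f - ract (balg_mul C) f c.

End banach_algebra.

Arguments Ztilde1l {K} A n.
Arguments predual_pairing {K} V n.
Arguments dual_pairing {K} V n.

(* Main.v *)
Require Import Defs.
From HB Require Import structures.
From mathcomp Require Import all_boot all_order all_algebra.
From mathcomp Require Import all_classical all_reals all_analysis.

(** Write B for the (n-2)-th dual of A. Let D : B -> B* be a bounded derivation
    and D'' : B** -> B*** its second transpose. The claim reduces to: D'' is a
    derivation for the first Arens product. Indeed weak amenability of B** then
    gives D'' = [F |-> F.Phi - Phi.F], and since the canonical map B -> B** is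
    multiplicative, evaluating at canonical images shows that D is the inner
    derivation defined by the restriction of Phi to B.

    Write D' : B** -> B* for the transpose of D. The derivation identity for
    D'', tested on H in B**, says
      F (G.(D'H)) = G (D'(HF)) + F (D'(GH)).
    The derivation identity of D gives the equality
    of functionals G.(D'H) = D'(GH) + [c |-> G (D'(H c))] on B
    ([arens_act_transpose]), so everything rests on
      F ([c |-> G (D'(H c))]) = G (D'(HF)),
    which is trivial when F is the canonical image of some c. The general case
    is where the hypothesis enters: since F |-> HF is continuous from the weak*
    to the weak topology, F |-> G (D'(HF)) is a weak*-continuous linear form on
    B**, hence evaluation at an element of B* ([weak_star_continuous_eval]), and
    this element is read off from its values at the canonical images. *)

Set Implicit Arguments.
Unset Strict Implicit.
Unset Printing Implicit Defensive.

Import Order.TTheory GRing.Theory Num.Theory.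
Import numFieldNormedType.Exports.

Local Open Scope classical_set_scope.
Local Open Scope ring_scope.

(** * Weak topologies *)

Section sigma_topology.
Variables (K : scalarFieldType) (X : choiceType) (Y : topologicalType).
Variable p : X -> Y -> K.

Lemma sigma_eval_continuous (y : Y) :
  continuous ((fun x => p x y) : sigma_topology p -> K^o).
Proof.
move=> x; apply: (@cvg_comp _ _ _ (p : sigma_topology p -> {ptws Y -> K^o})
  (fun g : {ptws Y -> K^o} => g y)); first exact: initial_continuous.
exact: (@proj_continuous Y (fun=> K^o) y (p x)).
Qed.

Lemma sigma_cvg (F : set_system X) (x : X) : Filter F ->
  (forall y, (fun z => p z y : K^o) @ F --> (p x y : K^o)) ->
  F --> (x : sigma_topology p).
Proof.
move=> FF Fx.
have cF : {ptws, (p : X -> Y -> K^o) @ F --> (p x : Y -> K^o)}.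
  by apply/pointwise_cvgP => y; exact: Fx.
move=> U [_ [[W oW <-]]] /= Wx /filterS; apply; apply: cF.
exact: open_nbhs_nbhs.
Qed.

End sigma_topology.

Section weak_star.
Variables (K : scalarFieldType) (V : normedModType K).

Lemma dual_linE (a : K) (f g : dual V) (v : V) :
  (a *: f + g) v = a * f v + g v.
Proof. by []. Qed.

(** Induction on s: a form vanishing on the kernel of v :: s either vanishes on
    that of s, or does so after subtracting a multiple of evaluation at v. *)
Lemma vanish_on_kernel_eval (s : seq V) (phi : dual V -> K^o) : linear phi ->
    (forall g : dual V, (forall v, v \in s -> g v = 0) -> phi g = 0) ->
  exists v, forall g, phi g = g v.
Proof.
elim: s phi => [|v s IH] phi lphi ker_phi.
  by exists 0 => g; rewrite linear0 ker_phi.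
have [[g0 [g0s g0v]]|no_g0] :=
    pselect (exists g : dual V, (forall w, w \in s -> g w = 0) /\ g v != 0).
- pose l := phi g0 / g0 v.
  have lpsi : linear (fun g => phi g - l * g v : K^o).
    move=> a g h; rewrite lphi /= /GRing.scale /=.
    by rewrite !mulrDr mulrN opprD addrACA mulrCA.
  have [|w psiE] := IH _ lpsi.
    move=> g gs; have : phi (- (g v / g0 v) *: g0 + g) = 0.
      apply: ker_phi => w; rewrite inE dual_linE => /orP[/eqP->|ws].
        by rewrite mulNr divfK// addNr.
      by rewrite (g0s _ ws) (gs _ ws) mulr0 addr0.
    rewrite lphi /GRing.scale/= /l => /eqP; rewrite mulNr addrC subr_eq0.
    by move=> /eqP ->; apply/eqP; rewrite subr_eq0 mulrC mulrA mulrAC.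
  exists (w + l *: v) => g; rewrite linearD linearZ /= -psiE.
  by rewrite subrK.
- apply: (IH _ lphi) => g gs; apply: ker_phi => w; rewrite inE.
  move=> /orP[/eqP->|]; last exact: gs.
  by apply/eqP; apply: contra_notT no_g0 => gv; exists g.
Qed.

(** The kernels of finite families of evaluations form a filter base converging
    weak* to 0, so a weak*-continuous form is bounded by 1, hence vanishes, on
    one of these subspaces. *)
Lemma weak_star_continuous_eval (phi : dual V -> K^o) : linear phi ->
    continuous (phi : sigma_topology (fun (g : dual V) v => g v) -> K^o) ->
  exists v, forall g, phi g = g v.
Proof.
move=> lphi cphi.
pose kernel (s : seq V) := [set g : dual V | forall v, v \in s -> g v = 0].
pose F := filter_from setT kernel.
have FF : Filter F.
  apply: filter_fromT_filter; first by exists [::].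
  move=> s t; exists (s ++ t) => g gst.
  by split=> v vs; apply: gst; rewrite mem_cat vs ?orbT.
have phi0 : phi 0 = 0.
  by have := lphi (-1) 0 0; rewrite !scaleN1r !addNr.
have F0 : F --> (0 : sigma_topology (fun (g : dual V) v => g v)).
  apply: sigma_cvg => v; apply: cvg_near_cst.
  by exists [:: v] => // g; apply; rewrite inE.
have : phi @ F --> phi 0 by apply: cvg_trans (cphi 0); exact: cvg_app F0.
move=> /cvgrPdist_lt /(_ 1 ltr01) [s _ phi1].
apply: (vanish_on_kernel_eval (s := s) lphi) => g gs.
apply/eqP/negPn/negP => phig0.
have : kernel s ((phi g)^-1 *: g + 0).
  by move=> v vs; rewrite dual_linE (gs _ vs) mulr0 addr0.
move=> /phi1; rewrite /= lphi phi0 addr0 sub0r normrN /GRing.scale/= mulVf//.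
by rewrite normr1 ltxx.
Qed.

End weak_star.

(** * Second transposes of derivations *)

Section transpose.
Variables (K : scalarFieldType) (V W : normedModType K).

Definition bounded_linear (T : V -> W) : Prop :=
  linear T /\ exists M, forall x, `|T x| <= M * `|x|.

Variables (T : V -> W) (bT : bounded_linear T).

Lemma transpose_subproof (g : dual W) :
  (fun x => g (T x)) \in @bounded_form K V.
Proof.
have [lT [M TM]] := bT.
apply: bounded_formP => [a x y|]; first by rewrite lT linearP.
exists (`|g| * M) => x; apply: le_trans (ler_dual_norm g _) _.
by rewrite -mulrA ler_wpM2l ?dual_norm_ge0.
Qed.

Definition transpose (g : dual W) : dual V := Dual (transpose_subproof g).

End transpose.

Lemma transpose_bounded_linear (K : scalarFieldType) (V W : normedModType K)
  (T : V -> W) (bT : bounded_linear T) : bounded_linear (transpose bT).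
Proof.
split=> [a f g|]; first exact: dualP.
have [_ [M TM]] := bT; exists `|M| => g; apply: dual_norm_le => x x1.
apply: le_trans (ler_dual_norm g _) _; rewrite mulrC ler_wpM2r ?dual_norm_ge0//.
apply: le_trans (TM x) _.
rewrite -(ger0_norm (le_trans (normr_ge0 _) (TM x))) normrM normr_id.
by rewrite ler_piMr.
Qed.

Section canonical_embedding.
Variables (K : scalarFieldType) (V : normedModType K).

Lemma biduality_subproof (c : V) :
  (fun f : dual V => f c) \in @bounded_form K (dual V).
Proof.
apply: bounded_formP => [//|]; exists `|c| => f.
by rewrite mulrC; exact: ler_dual_norm.
Qed.

Definition biduality (c : V) : dual (dual V) := Dual (biduality_subproof c).

Lemma biduality_bounded_linear : bounded_linear biduality.
Proof.
split=> [a x y|]; first by apply: dualP => f /=; rewrite linearP.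
exists 1 => x; rewrite mul1r; apply: dual_norm_le => f f1 /=.
by apply: le_trans (ler_dual_norm f x) _; rewrite ler_piMl.
Qed.

End canonical_embedding.

Lemma arens_biduality (K : scalarFieldType) (V : completeNormedModType K)
    (m : banach_mul V) (a b : V) :
  arens m (biduality a) (biduality b) = biduality (m a b).
Proof. exact: dualP. Qed.

Section second_transpose.
Variables (K : scalarFieldType) (B : banachAlgebra K).
Variables (D : B -> dual B) (bD : bounded_linear D).
Let m := balg_mul B.
Let D' := transpose bD.
Let D'' := transpose (transpose_bounded_linear bD).

Hypothesis leibnizD : forall x y, D (m x y) = lact m x (D y) + ract m (D x) y.

(** For H in B** and c, d in B, the Leibniz rule reads
    H (D (cd)) = (D'(H c)) d + (H.(D c)) d; apply G in the variable d. *)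
Lemma arens_act_transpose (G H : dual (dual B)) (c : B) :
  arens_act m G (D' H) c =
  D' (arens m G H) c + G (D' (arens m H (biduality c))).
Proof.
rewrite /= -linearD; congr (G _); apply: dualP => d /=.
rewrite leibnizD linearD addrC; congr (_ + _).
by congr (H _); apply: dualP.
Qed.

Hypothesis arens_weak_continuous : forall H,
  continuous (arens m H :
    sigma_topology (fun (F : dual (dual B)) f => F f) ->
    sigma_topology (fun (F : dual (dual B)) (Phi : dual (dual (dual B))) =>
      Phi F)).

Lemma second_transpose_derivation (F G : dual (dual B)) :
  D'' (arens m F G) =
  lact (arens_mul m) F (D'' G) + ract (arens_mul m) (D'' F) G.
Proof.
apply: dualP => H.
(* The element v of B* represents F |-> G (D'(HF)). *)
have [||v vE] := @weak_star_continuous_eval K (dual B)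
    (fun F => D'' G (arens m H F)).
- by move=> a F1 F2; rewrite arens_linearr linearP.
- move=> F0; apply: cvg_comp; first exact: (@arens_weak_continuous H F0).
  exact: (@sigma_eval_continuous _ _ (dual (dual (dual B)))
    (fun F Phi => Phi F) (D'' G)).
have actE : arens_act m G (D' H) = D' (arens m G H) + v.
  by apply: dualP => c; rewrite arens_act_transpose -[X in _ + X]/(D'' G _) vE.
transitivity (F (arens_act m G (D' H))); first by [].
by rewrite actE linearD addrC; congr (_ + _); exact: (esym (vE F)).
Qed.

End second_transpose.

(** * Descent of weak amenability *)

Lemma weakly_amenable_of_bidual (K : scalarFieldType) (B : banachAlgebra K) :
    (forall H, continuous (arens (balg_mul B) H :
      sigma_topology (fun (F : dual (dual B)) f => F f) ->
      sigma_topology (fun (F : dual (dual B)) (Phi : dual (dual (dual B))) =>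
        Phi F))) ->
    weakly_amenable (BanachAlgebra (arens_mul (balg_mul B))) ->
  weakly_amenable B.
Proof.
move=> Bcont waB D [lD nD leibnizD].
pose bD : bounded_linear D := conj lD nD.
have [lD'' nD''] := transpose_bounded_linear (transpose_bounded_linear bD).
have [|Phi PhiE] := waB (transpose (transpose_bounded_linear bD)).
  by split=> //; exact: second_transpose_derivation.
exists (transpose (@biduality_bounded_linear K B) Phi) => c; apply: dualP => d.
have := congr1 (fun Psi => dual_fun Psi (biduality d)) (PhiE (biduality c)).
move=> E; transitivity (Phi (biduality (balg_mul B d c)) -
    Phi (biduality (balg_mul B c d))); last by [].
by rewrite -!arens_biduality; exact: E.
Qed.

Theorem mainTheorem6 (K : scalarFieldType) (A : banachAlgebra K) (n : nat)
    (n_ge2 : (2 <= n)%N) (n_even : ~~ odd n)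
    (ZA : Ztilde1l A n = [set: iter_dual A n]%classic)
    (waA : weakly_amenable (iter_dual_alg A n)) :
  weakly_amenable (iter_dual_alg A (n - 2)).
Proof.
case: n n_ge2 {n_even} ZA waA => [|[|n]] // _ ZA waA.
rewrite subn2.
apply: (@weakly_amenable_of_bidual K (iter_dual_alg A n) _ waA) => H.
suff : Ztilde1l A n.+2 H by [].
by rewrite ZA.
Qed.
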